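(* Let $d\ge 2$ be an integer. There exist constants $c_1,c_2,c_3>0$ depending only on $d$ such that for every $\varepsilon\in(0,1]$ and every integer $n\ge c_1\,\varepsilon^{(1-d)/2}$ there exists a set $S$ of $n$ points in $\mathbb{R}^d$ such that every Euclidean Steiner $(1+\varepsilon)$-spanner $N$ for $S$ has lightness at least $c_2\,\varepsilon^{-d/2}$ and sparsity at least $c_3\,\varepsilon^{(1-d)/2}$.
   Context: A Euclidean Steiner $(1+\varepsilon)$-spanner for a finite set $S\subset\mathbb{R}^d$ is a geometric graph $N$ whose vertex set contains $S$ and may contain arbitrary additional points of $\mathbb{R}^d$ (Steiner points), whose edges are straight line segments weighted by their Euclidean length, such that for all $a,b\in S$ the shortest-path distance in $N$ is at most $(1+\varepsilon)\|ab\|$. The weight $\|N\|$ is the sum of the Euclidean lengths of its edges. The lightness of $N$ is $\|N\|/\|\mathrm{MST}(S)\|$, where $\mathrm{MST}(S)$ is a Euclidean minimum spanning tree of $S$; the sparsity of $N$ is $|E(N)|/(|S|-1)$. *)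

(* Defs.v *)
From HB Require Import structures.
From mathcomp Require Import all_boot all_order all_algebra finmap.
From mathcomp Require Import all_classical all_reals.
From mathcomp Require Import Rstruct exp.

Set Implicit Arguments. Unset Strict Implicit. Unset Printing Implicit Defensive.
Import Order.TTheory GRing.Theory Num.Theory.
Local Open Scope ring_scope.
Local Open Scope fset_scope.

Notation real := Rdefinitions.R.
Notation pt d := 'rV[real]_d.

Definition edist (d : nat) (x y : pt d) : real :=
  Num.sqrt (\sum_(i < d) (x ord0 i - y ord0 i) ^+ 2).

(* A finite geometric graph: vertex set V, edge set E of unordered edges,
   each undirected edge {a,b} represented by exactly one ordered pair. *)
Definition wf_graph (d : nat) (V : {fset pt d}) (E : {fset (pt d * pt d)}) : Prop :=
  forall e, e \in E -> [/\ e.1 \in V, e.2 \in V, e.1 != e.2 & (e.2, e.1) \notin E].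

Definition adj (d : nat) (E : {fset (pt d * pt d)}) : rel (pt d) :=
  fun x y => ((x, y) \in E) || ((y, x) \in E).

Definition walk_len (d : nat) (a : pt d) (p : seq (pt d)) : real :=
  \sum_(e <- zip (a :: p) p) edist e.1 e.2.

Definition gweight (d : nat) (E : {fset (pt d * pt d)}) : real :=
  \sum_(e <- E) edist e.1 e.2.

Definition steiner_spanner (d : nat) (eps : real) (S V : {fset pt d})
  (E : {fset (pt d * pt d)}) : Prop :=
  [/\ S `<=` V, wf_graph V E &
    forall a b, a \in S -> b \in S ->
      exists p : seq (pt d),
        [/\ path (adj E) a p, last a p = b & walk_len a p <= (1 + eps) * edist a b]].

Definition connected_on (d : nat) (S : {fset pt d}) (E : {fset (pt d * pt d)}) : Prop :=
  forall a b, a \in S -> b \in S ->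
    exists p : seq (pt d), path (adj E) a p /\ last a p = b.

Definition spanning_tree (d : nat) (S : {fset pt d}) (T : {fset (pt d * pt d)}) : Prop :=
  [/\ wf_graph S T, connected_on S T & #|` T| = (#|` S|).-1].

Definition is_MST (d : nat) (S : {fset pt d}) (T : {fset (pt d * pt d)}) : Prop :=
  spanning_tree S T /\
  forall T', spanning_tree S T' -> gweight T <= gweight T'.

Definition lightness (d : nat) (S : {fset pt d}) (T E : {fset (pt d * pt d)}) : real :=
  gweight E / gweight T.

Definition sparsity (d : nat) (S : {fset pt d}) (E : {fset (pt d * pt d)}) : real :=
  (#|` E|)%:R / (#|` S|).-1%:R.

(* Main.v *)
(* The points lie on m pairs of parallel (d-1)-dimensional grids of side K, about
   eps^(-1/2), and spacing 1, the grids of a pair being at distance K. If w = b - a joins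
   the two grids of a pair, an ab-path of length at most (1 + eps)|w| stays within
   O(sqrt eps |w|) of the line ab, and at least half of its length is carried by
   edges whose direction is within O(sqrt eps) of that of w. Such an edge determines w,
   a and b up to an error less than the grid spacing, so that the sets of these edges are
   disjoint for distinct pairs (a, b). The K^(2(d-1)) pairs (a, b) in each pair of grids
   thus need as many edges and a total weight of order K^(2d-1), whereas
   the points number 2K^(d-1) and the path visiting them in row-major order has
   length O(K^(d-1)). *)
Require Import Defs.
From HB Require Import structures.
From mathcomp Require Import all_boot all_order all_algebra finmap.
From mathcomp Require Import all_classical all_reals.
From mathcomp Require Import Rstruct exp.
From mathcomp Require Import ring lra zify.
Set Implicit Arguments. Unset Strict Implicit. Unset Printing Implicit Defensive.
Import Order.TTheory GRing.Theory Num.Theory.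
Local Open Scope fset_scope.
Local Open Scope ring_scope.

(** * Inner product and Euclidean norm *)

Definition dot (R : rcfType) (d : nat) (x y : 'rV[R]_d) : R :=
  \sum_(i < d) x ord0 i * y ord0 i.

Definition nrm (R : rcfType) (d : nat) (x : 'rV[R]_d) : R := Num.sqrt (dot x x).

Lemma dotC (R : rcfType) d (x y : 'rV[R]_d) : dot x y = dot y x.
Proof. by apply: eq_bigr => i _; rewrite mulrC. Qed.

Lemma dotDl (R : rcfType) d (x y z : 'rV[R]_d) : dot (x + y) z = dot x z + dot y z.
Proof. by rewrite -big_split; apply: eq_bigr => i _; rewrite mxE mulrDl. Qed.

Lemma dotZl (R : rcfType) d k (x z : 'rV[R]_d) : dot (k *: x) z = k * dot x z.
Proof. by rewrite mulr_sumr; apply: eq_bigr => i _; rewrite mxE mulrA. Qed.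

Lemma dotNl (R : rcfType) d (x z : 'rV[R]_d) : dot (- x) z = - dot x z.
Proof. by rewrite -scaleN1r dotZl mulN1r. Qed.

Lemma dotDr (R : rcfType) d (x y z : 'rV[R]_d) : dot z (x + y) = dot z x + dot z y.
Proof. by rewrite !(dotC z) dotDl. Qed.

Lemma dotZr (R : rcfType) d k (x z : 'rV[R]_d) : dot z (k *: x) = k * dot z x.
Proof. by rewrite !(dotC z) dotZl. Qed.

Lemma dotNr (R : rcfType) d (x z : 'rV[R]_d) : dot z (- x) = - dot z x.
Proof. by rewrite !(dotC z) dotNl. Qed.

Definition dotE := (dotDl, dotDr, dotNl, dotNr, dotZl, dotZr).

Lemma dot_ge0 (R : rcfType) d (x : 'rV[R]_d) : 0 <= dot x x.
Proof. by apply: sumr_ge0 => i _; rewrite -expr2 sqr_ge0. Qed.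

Lemma nrm_ge0 (R : rcfType) d (x : 'rV[R]_d) : 0 <= nrm x.
Proof. exact: sqrtr_ge0. Qed.

Lemma nrm_sqr (R : rcfType) d (x : 'rV[R]_d) : nrm x ^+ 2 = dot x x.
Proof. by rewrite sqr_sqrtr // dot_ge0. Qed.

Lemma nrmN (R : rcfType) d (x : 'rV[R]_d) : nrm (- x) = nrm x.
Proof. by rewrite /nrm dotNl dotNr opprK. Qed.

Lemma nrmBC (R : rcfType) d (x y : 'rV[R]_d) : nrm (x - y) = nrm (y - x).
Proof. by rewrite -nrmN opprB. Qed.

Lemma nrmZ (R : rcfType) d k (x : 'rV[R]_d) : nrm (k *: x) = `|k| * nrm x.
Proof. by rewrite /nrm dotZl dotZr mulrA -expr2 sqrtrM ?sqr_ge0 // sqrtr_sqr. Qed.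

Lemma nrm_le (R : rcfType) d (x : 'rV[R]_d) (c : R) :
  0 <= c -> (nrm x <= c) = (dot x x <= c ^+ 2).
Proof. by move=> c0; rewrite -nrm_sqr ler_sqr // nnegrE nrm_ge0. Qed.

Lemma coord_le_nrm (R : rcfType) d (x : 'rV[R]_d) i : `|x ord0 i| <= nrm x.
Proof.
rewrite -ler_sqr ?nnegrE ?nrm_ge0 // nrm_sqr real_normK ?num_real //.
rewrite /dot (bigD1 i) //= -expr2 lerDl.
by apply: sumr_ge0 => j _; rewrite -expr2 sqr_ge0.
Qed.

Lemma nrm_gt0 (R : rcfType) d (x : 'rV[R]_d) : (0 < nrm x) = (x != 0).
Proof.
apply/idP/idP => [|x0]; first by apply: contraTneq => ->; rewrite /nrm -(scale0r 0) dotZl mul0r sqrtr0 ltxx.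
have /existsP[i xi] : [exists i, x ord0 i != 0].
  apply: contra_neqT x0 => /existsPn h; apply/rowP => i.
  by apply/eqP; move: (h i); rewrite negbK mxE.
by apply: lt_le_trans (coord_le_nrm x i); rewrite normr_gt0.
Qed.

(** Cauchy-Schwarz: for nonzero x and y, the square of the norm of |y|x - |x|y is 2|x||y|(|x||y| -
    <x,y>), and it is nonnegative. *)
Lemma dot_le_nrm (R : rcfType) d (x y : 'rV[R]_d) : dot x y <= nrm x * nrm y.
Proof.
have [->|] := eqVneq y 0.
  rewrite -(scale0r 0) dotZr mul0r; exact: mulr_ge0 (nrm_ge0 _) (nrm_ge0 _).
rewrite -nrm_gt0 => y0.
have := dot_ge0 (nrm y *: x - nrm x *: y).
have [->|] := eqVneq x 0.
  rewrite -(scale0r 0) dotZl mul0r => _; exact: mulr_ge0 (nrm_ge0 _) (nrm_ge0 _).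
rewrite -nrm_gt0 => x0.
rewrite !dotE -!nrm_sqr (dotC y x) => h.
have xy0 : 0 < nrm x * nrm y by rewrite mulr_gt0.
rewrite -(ler_pM2l xy0) -subr_ge0; nra.
Qed.

Lemma nrmD (R : rcfType) d (x y : 'rV[R]_d) : nrm (x + y) <= nrm x + nrm y.
Proof.
rewrite nrm_le ?addr_ge0 ?nrm_ge0 // !dotE (dotC y x) -!nrm_sqr.
have := dot_le_nrm x y; lra.
Qed.

Lemma nrm_le_l1 (R : rcfType) d (x : 'rV[R]_d) : nrm x <= \sum_(i < d) `|x ord0 i|.
Proof.
rewrite nrm_le ?sumr_ge0 // /dot expr2 mulr_suml; apply: ler_sum => i _.
apply: le_trans (ler_norm _) _; rewrite normrM ler_wpM2l //.
by rewrite (bigD1 i) //= lerDl sumr_ge0.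
Qed.

Lemma edistE d (x y : pt d) : edist x y = nrm (x - y).
Proof. by congr Num.sqrt; apply: eq_bigr => i _; rewrite !mxE expr2. Qed.

Lemma edistxx d (x : pt d) : edist x x = 0.
Proof. by rewrite edistE subrr -(scale0r 0) nrmZ normr0 mul0r. Qed.

Lemma edistC d (x y : pt d) : edist x y = edist y x.
Proof. by rewrite !edistE nrmBC. Qed.

Lemma edist_ge0 d (x y : pt d) : 0 <= edist x y.
Proof. by rewrite edistE nrm_ge0. Qed.

Lemma edist_triangle d (x y z : pt d) : edist x z <= edist x y + edist y z.
Proof. by rewrite !edistE (_ : x - z = (x - y) + (y - z)) ?nrmD // addrA subrK. Qed.

(** * Recovering a pair of points from the direction and position of an edge *)

(** The angles of v with w and w' have cosine at least 1 - 2r^2, so that the unit vectors of w and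
    w' lie within 2r of that of v and within 4r of each other. The common coordinate K then controls
    the difference of the two lengths. *)
Lemma close_directions (R : rcfType) d (w w' v : 'rV[R]_d) (r K D : R) i :
  0 <= r -> 0 < K -> 0 < nrm v -> w ord0 i = K -> w' ord0 i = K ->
  nrm w <= D * K -> nrm w' <= D * K ->
  (1 - 2 * r ^+ 2) * (nrm v * nrm w) <= dot v w ->
  (1 - 2 * r ^+ 2) * (nrm v * nrm w') <= dot v w' ->
  nrm (w - w') <= 4 * r * (D * (1 + D)) * K.
Proof.
move=> r0 K0 v0 wi w'i wD w'D gw gw'.
(* The square of the left side is 2|v||u|(|v||u| - <v,u>). *)
have near (u : 'rV[R]_d) : (1 - 2 * r ^+ 2) * (nrm v * nrm u) <= dot v u ->
    nrm (nrm u *: v - nrm v *: u) <= 2 * r * (nrm v * nrm u).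
  move=> gu; have nu := nrm_ge0 u; have nvu : 0 <= nrm v * nrm u by rewrite mulr_ge0 // ltW.
  rewrite nrm_le; last by rewrite !mulr_ge0 ?nrm_ge0.
  rewrite !dotE (dotC u v) -!nrm_sqr; nra.
have Kw : K <= nrm w by rewrite -wi; apply: le_trans (ler_norm _) (coord_le_nrm _ _).
have Kw' : K <= nrm w' by rewrite -w'i; apply: le_trans (ler_norm _) (coord_le_nrm _ _).
have w0 := nrm_ge0 w; have w'0 := nrm_ge0 w'.
have h1 : nrm (nrm w' *: w - nrm w *: w') <= 4 * r * (nrm w * nrm w').
  rewrite -(ler_pM2l v0) -[X in X * nrm (_ - _)](gtr0_norm v0) -nrmZ.
  have -> : nrm v *: (nrm w' *: w - nrm w *: w') =
     nrm w *: (nrm w' *: v - nrm v *: w') - nrm w' *: (nrm w *: v - nrm v *: w).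
    by apply/rowP => j; rewrite !mxE; ring.
  apply: le_trans (nrmD _ _) _; rewrite nrmN !nrmZ !ger0_norm //.
  have := ler_wpM2l w0 (near _ gw'); have := ler_wpM2l w'0 (near _ gw); lra.
have h2 : K * `|nrm w' - nrm w| <= 4 * r * (nrm w * nrm w').
  apply: le_trans h1; apply: le_trans (coord_le_nrm _ i).
  by rewrite !mxE wi w'i -mulrBl normrM mulrC (gtr0_norm K0).
have w'p : 0 < nrm w' by lra.
have h3 : nrm (w - w') * nrm w' <= 4 * r * (nrm w * nrm w') + nrm w' * `|nrm w' - nrm w|.
  rewrite mulrC -[X in X * nrm (_ - _)](gtr0_norm w'p) -nrmZ.
  have -> : nrm w' *: (w - w') = (nrm w' *: w - nrm w *: w') + (nrm w - nrm w') *: w'.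
    by apply/rowP => j; rewrite !mxE; ring.
  apply: le_trans (nrmD _ _) _; apply: lerD => //.
  by rewrite nrmZ mulrC distrC.
have h4 : K * nrm (w - w') <= 4 * r * (K + nrm w') * nrm w.
  rewrite -(ler_pM2r w'p).
  have := ler_wpM2l (ltW K0) h3; have := ler_wpM2l w'0 h2; lra.
rewrite -(ler_pM2l K0); apply: le_trans h4 _.
rewrite (_ : _ * (_ * _ * K) = 4 * r * (K + D * K) * (D * K)); last by ring.
by apply: ler_pM => //; [rewrite !mulr_ge0 // addr_ge0 // ltW | rewrite ler_wpM2l ?mulr_ge0 //; lra].
Qed.

(** A small defect |p||w| - <p,w> puts q = a + p within 2r|w| of the line through a in direction w,
    and likewise for a'. Hence a - a' is within 4r|w| of a multiple of w. This multiple is small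
    because a and a' agree in coordinate i, where w equals K. *)
Lemma close_sources (R : rcfType) d (w a a' q : 'rV[R]_d) (r K D : R) i :
  0 <= r -> 0 < K -> w ord0 i = K -> a ord0 i = a' ord0 i ->
  nrm w <= D * K -> 
  nrm (q - a) <= 2 * nrm w -> nrm (q - a') <= 2 * nrm w ->
  nrm (q - a) * nrm w - dot (q - a) w <= r ^+ 2 * nrm w ^+ 2 ->
  nrm (q - a') * nrm w - dot (q - a') w <= r ^+ 2 * nrm w ^+ 2 ->
  nrm (a - a') <= 4 * r * (D * (1 + D)) * K.
Proof.
move=> r0 K0 wi ai wD l l' g g'.
have Kw : K <= nrm w by rewrite -wi; apply: le_trans (ler_norm _) (coord_le_nrm _ _).
have w0 : 0 < nrm w by lra.
have near (p : 'rV[R]_d) : nrm p <= 2 * nrm w ->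
    nrm p * nrm w - dot p w <= r ^+ 2 * nrm w ^+ 2 ->
    exists t, nrm (p - t *: w) <= 2 * r * nrm w.
  move=> lp gp; exists (dot p w / nrm w ^+ 2).
  rewrite nrm_le; last by rewrite !mulr_ge0 // ltW.
  rewrite !dotE (dotC w p) -!nrm_sqr.
  have := dot_le_nrm p w; have := nrm_ge0 p.
  move: (nrm p) (dot p w) (nrm w) w0 gp lp => P X L L0 gp lp P0 XP.
  rewrite (_ : _ + _ = ((P * L - X) * (P * L + X)) / L ^+ 2); last by field; rewrite gt_eqF.
  rewrite ler_pdivrMr ?exprn_gt0 //.
  have h : P * L + X <= 4 * L ^+ 2 by nra.
  apply: le_trans (_ : (r ^+ 2 * L ^+ 2) * (4 * L ^+ 2) <= _); last by rewrite le_eqVlt; apply/orP; left; apply/eqP; ring.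
  apply: le_trans (ler_wpM2l _ h) _; first lra.
  by apply: ler_wpM2r => //; rewrite mulr_ge0 ?sqr_ge0.
have [t ht] := near _ l g; have [t' ht'] := near _ l' g'.
have h1 : nrm ((a - a') - (t' - t) *: w) <= 4 * r * nrm w.
  have -> : (a - a') - (t' - t) *: w = (q - a' - t' *: w) - (q - a - t *: w).
    by apply/rowP => j; rewrite !mxE; ring.
  apply: le_trans (nrmD _ _) _; rewrite nrmN; lra.
have h2 : `|t' - t| * K <= 4 * r * nrm w.
  apply: le_trans h1; apply: le_trans (coord_le_nrm _ i).
  by rewrite !mxE wi ai subrr sub0r normrN normrM (gtr0_norm K0).
have h3 : nrm (a - a') <= 4 * r * nrm w + `|t' - t| * nrm w.
  rewrite -[X in nrm X](subrK ((t' - t) *: w)).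
  apply: le_trans (nrmD _ _) _; apply: lerD => //.
  by rewrite nrmZ.
have h4 : K * nrm (a - a') <= 4 * r * (K + nrm w) * nrm w.
  have := ler_wpM2l (ltW K0) h3; have := ler_wpM2l (ltW w0) h2; lra.
rewrite -(ler_pM2l K0); apply: le_trans h4 _.
rewrite (_ : _ * (_ * _ * K) = 4 * r * (K + D * K) * (D * K)); last by ring.
by apply: ler_pM => //; [rewrite !mulr_ge0 // addr_ge0 // ltW | rewrite ltW | rewrite ler_wpM2l ?mulr_ge0 //; lra].
Qed.

(** * Walks: removal of cycles and bounds on the length *)

(** In a simple walk no step is counted twice. That it is a subsequence of [p] lets the triangle
    inequality bound its length. *)
Lemma uniq_subwalk (T : eqType) (e : rel T) x p : path e x p ->
  exists p', [/\ path e x p', last x p' = last x p, uniq (x :: p') & subseq p' p].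
Proof.
elim: p x => [|y p IH] x /=; first by exists [::].
case/andP=> exy /IH[p' [pp' <- up' sp']].
(* If x recurs on the simple walk from y, everything up to that occurrence is dropped. *)
have [xp'|xp'] := boolP (x \in y :: p'); last first.
  exists (y :: p'); split => //=; first by rewrite exy.
    by rewrite xp'.
  by rewrite eqxx.
have sy : subseq (y :: p') (y :: p) by rewrite /= eqxx.
have exp : path e x (y :: p') by rewrite /= exy.
have <- : last x (y :: p') = last y p' by [].
move: sy exp up'; case: (splitPr xp') => p1 p2 sy.
rewrite cat_path cat_uniq last_cat /= => /and3P[_ _ pp2] /and3P[_ _ up2].
exists p2; split => //; apply: subseq_trans sy.
by apply: subseq_trans (suffix_subseq _ _); apply: subseq_cons.
Qed.

Lemma walk_len_cons d (a b : pt d) p : walk_len a (b :: p) = edist a b + walk_len b p.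
Proof. by rewrite /walk_len /= big_cons. Qed.

Lemma walk_len_nil d (a : pt d) : walk_len a [::] = 0.
Proof. by rewrite /walk_len /= big_nil. Qed.

Lemma walk_len_ge0 d (a : pt d) p : 0 <= walk_len a p.
Proof. by apply: sumr_ge0 => e _; apply: edist_ge0. Qed.

Lemma walk_len_subseq d (a : pt d) p' p :
  subseq p' p -> last a p' = last a p -> walk_len a p' <= walk_len a p.
Proof.
elim: p a p' => [|y p IH] a [|z p'] //= sub; rewrite ?walk_len_nil ?walk_len_ge0 //.
move: sub; case: eqP => [<- sub lst|_ sub lst]; rewrite !walk_len_cons.
  by rewrite lerD2l; apply: IH.
have := IH y (z :: p') sub lst; rewrite walk_len_cons.
have := edist_triangle a y z; lra.
Qed.

Lemma edist_le_walk_len d (a : pt d) p : edist a (last a p) <= walk_len a p.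
Proof.
elim: p a => [|y p IH] a; first by rewrite walk_len_nil /= edistxx.
by rewrite walk_len_cons /=; apply: le_trans (edist_triangle a y _) _; rewrite lerD2l.
Qed.

Lemma edist_via_le_walk_len d (a q : pt d) p :
  q \in a :: p -> edist a q + edist q (last a p) <= walk_len a p.
Proof.
elim: p a => [|y p IH] a.
  by rewrite inE => /eqP->; rewrite walk_len_nil /= edistxx addr0.
rewrite inE => /orP[/eqP->|qp]; first by rewrite edistxx add0r edist_le_walk_len.
rewrite walk_len_cons /=; have := IH y qp; have := edist_triangle a y q; lra.
Qed.

Lemma dot_walk d (a w : pt d) p :
  \sum_(e <- zip (a :: p) p) dot (e.2 - e.1) w = dot (last a p - a) w.
Proof.
elim: p a => [|y p IH] a /=.
  by rewrite big_nil subrr -(scale0r 0) dotZl mul0r.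
by rewrite big_cons /= IH -dotDl addrC addrA subrK.
Qed.

(** * Good edges of a short walk *)

(** The cosine of the angle between the oriented edge e and b - a is at least 1 - 2 eps, written
    without division. *)
Definition good_edge d (eps : real) (a b : pt d) (e : pt d * pt d) :=
  (1 - 2 * eps) * (edist e.1 e.2 * edist a b) <= dot (e.2 - e.1) (b - a).

(** The ellipsoid with foci a and b, which contains every vertex of an ab-walk of length at most (1
    + eps)|ab|. *)
Definition near_pair d (eps : real) (a b q : pt d) :=
  edist a q + edist q b <= (1 + eps) * edist a b.

(* The defects |v| |w| - <v,w> of the edges v of the walk, where w = b - a, are
   nonnegative and sum up to at most eps |w|^2, and every edge that is not good
   has defect at least 2 eps |v| |w|. *)
Lemma good_edges_long d (eps : real) (a b : pt d) p :
  0 < eps -> 0 < edist a b -> last a p = b -> walk_len a p <= (1 + eps) * edist a b ->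
  edist a b / 2 <= \sum_(e <- zip (a :: p) p | good_edge eps a b e) edist e.1 e.2.
Proof.
move=> eps0 L0 lst len.
set L := edist a b in L0 len *; set w := b - a.
have wL : nrm w = L by rewrite /L edistE nrmBC.
have tot : \sum_(e <- zip (a :: p) p) dot (e.2 - e.1) w = L ^+ 2.
  by rewrite dot_walk lst -nrm_sqr wL.
have Ltot : L <= walk_len a p by rewrite /L -lst edist_le_walk_len.
have defect (e : pt d * pt d) : 0 <= edist e.1 e.2 * L - dot (e.2 - e.1) w.
  by rewrite subr_ge0 edistE nrmBC -wL dot_le_nrm.
have bad : 2 * eps * L * \sum_(e <- zip (a :: p) p | ~~ good_edge eps a b e) edist e.1 e.2
    <= walk_len a p * L - L ^+ 2.
  rewrite -tot /walk_len mulr_suml -sumrB mulr_sumr.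
  rewrite [leRHS](bigID (fun e => good_edge eps a b e)) /=.
  rewrite -[leLHS]add0r; apply: lerD; first exact: sumr_ge0.
  by apply: ler_sum => e; rewrite /good_edge -ltNge -/w -/L; lra.
have split : walk_len a p = \sum_(e <- zip (a :: p) p | good_edge eps a b e) edist e.1 e.2
   + \sum_(e <- zip (a :: p) p | ~~ good_edge eps a b e) edist e.1 e.2.
  by rewrite /walk_len (bigID (fun e => good_edge eps a b e)).
move: bad split; set B := (X in _ * X) => bad split.
have : 2 * B <= L.
  rewrite -(ler_pM2l L0) -(ler_pM2l eps0).
  have := ler_wpM2r (ltW L0) len; lra.
have arith (x y z : real) : x <= y + z -> 2 * z <= x -> x / 2 <= y by lra.
by apply: arith; rewrite -split.
Qed.

(** * Charging the spanner with disjoint sets of edges *)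

Lemma ler_sum_uniq_sub (R : numDomainType) (T : eqType) (s t : seq T) (f : T -> R) :
  (forall x, 0 <= f x) -> uniq s -> {subset s <= t} ->
  \sum_(x <- s) f x <= \sum_(x <- t) f x.
Proof.
move=> f0; elim: s t => [|x s IH] t /=; first by rewrite big_nil sumr_ge0.
case/andP=> xs us sub; have xt : x \in t by apply: sub; rewrite mem_head.
rewrite (perm_big _ (perm_to_rem xt)) /= !big_cons lerD2l; apply: IH => // y ys.
have : y \in x :: rem x t by rewrite -(perm_mem (perm_to_rem xt)) sub // inE ys orbT.
by rewrite inE; case: eqP ys xs => // -> ->.
Qed.

(** Once the order of summation is exchanged, each element of [t] contributes for at most one
    index. *)
Lemma ler_sum_disjoint (R : numDomainType) (I : finType) (T : eqType)
    (g : I -> seq T) (t : seq T) (f : T -> R) :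
  (forall x, 0 <= f x) -> (forall i, uniq (g i)) -> (forall i, {subset g i <= t}) ->
  (forall i j x, x \in g i -> x \in g j -> i = j) ->
  \sum_i \sum_(x <- g i) f x <= \sum_(x <- t) f x.
Proof.
move=> f0 ug sub dis.
apply: le_trans (ler_sum_uniq_sub f0 (undup_uniq t) _) => [|x]; last by rewrite mem_undup.
under eq_bigr => i _.
  rewrite (perm_big [seq x <- undup t | x \in g i]) /=; last first.
    apply: uniq_perm => //; first by rewrite filter_uniq ?undup_uniq.
    move=> x; rewrite mem_filter mem_undup.
    by case: (boolP (x \in g i)) => // /sub ->.
  rewrite big_filter; over.
rewrite (exchange_big_dep predT) //=; apply: ler_sum => x _.
have [/existsP[i xi]|/existsPn none] := boolP [exists i, x \in g i].
  rewrite (big_pred1 i) // => j; apply/idP/eqP => [xj|->//].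
  exact: dis xj xi.
by rewrite big_pred0 // => i; apply/negbTE.
Qed.

(** Each pair is charged to the good edges of a short simple walk joining it. They carry half of the
    distance, hence there is at least one, and by the last hypothesis no oriented edge is charged
    twice. *)
Lemma spanner_lower_bounds d (eps : real) (S V : {fset pt d}) (E : {fset (pt d * pt d)})
    (I : finType) (a b : I -> pt d) :
  0 < eps -> steiner_spanner eps S V E ->
  (forall i, a i \in S) -> (forall i, b i \in S) -> (forall i, 0 < edist (a i) (b i)) ->
  (forall i j e, e.1 != e.2 -> near_pair eps (a i) (b i) e.1 -> near_pair eps (a j) (b j) e.1 ->
     good_edge eps (a i) (b i) e -> good_edge eps (a j) (b j) e -> i = j) ->
  \sum_i edist (a i) (b i) / 2 <= 2 * gweight E /\ (#|I|%:R : real) <= 2 * (#|` E|)%:R.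
Proof.
move=> eps0 [SV wf span] aS bS ab0 dis.
have /fin_all_exists[p hp] : forall i, exists p : seq (pt d),
  [/\ path (adj E) (a i) p, last (a i) p = b i,
      walk_len (a i) p <= (1 + eps) * edist (a i) (b i) & uniq (a i :: p)].
  move=> i; have [p [pp lp len]] := span _ _ (aS i) (bS i).
  have [p' [pp' lp' up' sp']] := uniq_subwalk pp.
  exists p'; split => //; first by rewrite lp'.
  by apply: le_trans len; apply: walk_len_subseq.
pose g i := [seq e <- zip (a i :: p i) (p i) | good_edge eps (a i) (b i) e].
pose swap (e : pt d * pt d) := (e.2, e.1).
(* A walk may traverse an edge against its stored orientation; listing both orientations costs the
   factor 2 in the two bounds. *)
pose D := E ++ map swap E : seq _.
have step i e : e \in zip (a i :: p i) (p i) -> adj E e.1 e.2 /\ e.1 \in a i :: p i.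
  have [pp _ _ _] := hp i; move: (p i) (a i) pp; clear.
  elim=> [|y q IH] x //= /andP[xy yq]; rewrite inE => /orP[/eqP->|/(IH _ yq)[-> h]].
    by rewrite mem_head.
  by rewrite inE h orbT.
have gD i : {subset g i <= D}.
  move=> [u v]; rewrite mem_filter => /andP[_ /step[/orP[uv|vu] _]].
    by rewrite mem_cat uv.
  by rewrite mem_cat; apply/orP; right; apply/mapP; exists (v, u).
(* The steps of a simple walk have distinct starting points. *)
have gU i : uniq (g i).
  by apply: filter_uniq; apply: zip_uniql; have [] := hp i.
have gdis i j e : e \in g i -> e \in g j -> i = j.
  rewrite !mem_filter => /andP[gi /step[ei ni]] /andP[gj /step[_ nj]].
  have [_ li leni _] := hp i; have [_ lj lenj _] := hp j.
  apply: (dis i j e) => //.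
  - by case/orP: ei => /wf[_ _] // h _; rewrite eq_sym.
  - by apply: le_trans leni; rewrite -li; apply: edist_via_le_walk_len.
  - by apply: le_trans lenj; rewrite -lj; apply: edist_via_le_walk_len.
have long i : edist (a i) (b i) / 2 <= \sum_(e <- g i) edist e.1 e.2.
  by have [pp lp len _] := hp i; rewrite big_filter; apply: good_edges_long.
split.
  apply: (@le_trans _ _ (\sum_i \sum_(e <- g i) edist e.1 e.2)).
    by apply: ler_sum => i _; exact: long.
  apply: le_trans (ler_sum_disjoint (fun e : pt d * pt d => edist_ge0 e.1 e.2) gU gD gdis) _.
  rewrite big_cat big_map /= mulrDl !mul1r lerD //.
  by apply: ler_sum => e _; rewrite edistC.
apply: (@le_trans _ _ (\sum_(e <- D) 1)); last first.
  by rewrite big_const_seq count_predT iter_addr addr0 size_cat size_map addnn -muln2 natrM mulrC.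
apply: le_trans (ler_sum_disjoint (fun _ => ler01) gU gD gdis).
rewrite -[leLHS](@sumr_const _ I); apply: ler_sum => i _.
case E0 : (g i) (long i) => [|e s].
  by rewrite big_nil => h; have := ab0 i; lra.
by move=> _; rewrite big_cons lerDl sumr_ge0.
Qed.

(** * The grid points in row-major order *)

(** Turns closeness of grid points, or of their differences, into equality. *)
Lemma int_row_eq0 d (x : pt d) : (forall j, x ord0 j \is a Num.int) -> nrm x < 1 -> x = 0.
Proof.
move=> xi x1; apply/rowP => j; rewrite mxE; apply: contraTeq x1 => xj.
by rewrite -leNgt; apply: le_trans (coord_le_nrm x j); rewrite norm_intr_ge1.
Qed.

(** Points near a pair lie within 2dK of its source. The step 5dK exceeds twice this distance, so
    that different pairs of grids share no charged edge. *)
Definition height (d K l : nat) : nat := ((l %/ 2 * (5 * d) + l %% 2) * K)%N.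

Definition coord_nat (d K i j : nat) : nat :=
  if (j < d.-1)%N then ((i %/ K ^ j) %% K)%N else height d K (i %/ K ^ d.-1).

(* The points of the levels 2h and 2h + 1 are the K ^ (d - 1) points of a grid,
   each at height 5dKh and 5dKh + K, respectively, in row-major order. *)
Definition gridpt (d K i : nat) : pt d := \row_j (coord_nat d K i j)%:R.

Lemma height_inj d K : (0 < d)%N -> (0 < K)%N -> injective (height d K).
Proof.
move=> d0 K0 l l' /eqP; rewrite eqn_pmul2r // => /eqP h.
have d5 : (0 < 5 * d)%N by lia.
have small k : (k %% 2 < 5 * d)%N by apply: leq_trans (ltn_pmod _ _) _ => //; lia.
rewrite (divn_eq l 2) (divn_eq l' 2); congr (_ * 2 + _)%N.
  by have := congr1 (divn^~ (5 * d)%N) h; rewrite /= !divnMDl // !(divn_small (small _)) !addn0.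
by have := congr1 (modn^~ (5 * d)%N) h; rewrite /= !modnMDl !(modn_small (small _)).
Qed.

(** The base-K digits recover i modulo K^(d-1), and the height recovers the quotient. *)
Lemma gridpt_inj d K : (0 < d)%N -> (0 < K)%N -> injective (gridpt d K).
Proof.
move=> d0 K0 i i' /rowP h.
have hc j : (j < d)%N -> coord_nat d K i j = coord_nat d K i' j.
  by move=> jd; have /eqP := h (Ordinal jd); rewrite !mxE eqr_nat => /eqP.
have low j : (j <= d.-1)%N -> (i %% K ^ j = i' %% K ^ j)%N.
  elim: j => [|j IH] jd; first by rewrite !modn1.
  rewrite (divn_eq (i %% _)%N (K ^ j)) (divn_eq (i' %% _)%N (K ^ j)).
  rewrite !modn_dvdm ?dvdn_exp2l // IH 1?ltnW //; congr (_ * _ + _)%N.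
  have := hc j; rewrite /coord_nat jd !modn_divl -expnS; apply; lia.
have := hc d.-1; rewrite /coord_nat ltnn prednK // leqnn.
move=> /(_ isT) /(height_inj d0 K0) top.
by rewrite (divn_eq i (K ^ d.-1)) (divn_eq i' (K ^ d.-1)) top low.
Qed.

(** Without a carry only the lowest digit changes, by one. With a carry each of the d coordinates
    moves by at most K, and the height by at most 5dK more. *)
Lemma gridpt_step d K i : (2 <= d)%N -> (0 < K)%N ->
  edist (gridpt d K i) (gridpt d K i.+1) <= 1 + (6 * d * K * (K %| i.+1)%N)%:R.
Proof.
move=> d2 K0; rewrite edistE; apply: le_trans (nrm_le_l1 _) _.
have dist (m n k : nat) : (m <= n + k)%N -> (n <= m + k)%N -> `|(m%:R - n%:R : real)| <= k%:R.
  rewrite -!(ler_nat real) !natrD ler_norml => mn nm.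
  by apply/andP; split; lra.
have [Ki|Ki] := boolP (K %| i.+1)%N.
  rewrite muln1.
  have coord (j : 'I_d) : `|(gridpt d K i - gridpt d K i.+1) ord0 j| <= 
      (K + (j == d.-1 :> nat) * (5 * d * K))%:R.
    rewrite !mxE /coord_nat; case: ltnP => jd.
      by apply: dist; apply: leq_trans (ltnW (ltn_pmod _ K0)) _; lia.
    have -> : (j : nat) == d.-1 by have := ltn_ord j; lia.
    rewrite mul1n; set M := (K ^ d.-1)%N.
    have M0 : (0 < M)%N by rewrite expn_gt0 K0.
    rewrite /height divnS //; set l := (i %/ M)%N.
    case: (M %| i.+1)%N; last by rewrite add0n; apply: dist; apply: leq_addr.
    rewrite add1n; move: (divn_eq l 2) (divn_eq l.+1 2) (ltn_pmod l (isT : 0 < 2)%N) (ltn_pmod l.+1 (isT : 0 < 2)%N).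
    move: (l %/ 2)%N (l %% 2)%N (l.+1 %/ 2)%N (l.+1 %% 2)%N => q r q' r' e e' r2 r2'.
    (* The next level is either the upper grid of the same pair or the lower grid of the next
       pair. *)
    have [[-> ->]|[-> [-> ->]]] : (q' = q /\ r' = r.+1) \/ (q' = q.+1 /\ (r = 1 /\ r' = 0))%N by lia.
      by apply: dist; nia.
    by apply: dist; nia.
  apply: le_trans (ler_sum _ (fun j _ => coord j)) _.
  rewrite -natr_sum big_split /= sum_nat_const card_ord.
  have d0 : (d.-1 < d)%N by lia.
  rewrite (bigD1 (Ordinal d0)) //= eqxx big1 => [|j]; last first.
    by rewrite -val_eqE /= => /negbTE->.
  by rewrite addn0 mul1n nat1r ler_nat; nia.
rewrite muln0 addr0.
have d0 : (0 < d)%N by lia.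
have same j : (0 < j)%N -> (i.+1 %/ K ^ j = i %/ K ^ j)%N.
  case: j => // j _; rewrite expnS !divnMA; congr (_ %/ _)%N.
  by rewrite divnS // (negbTE Ki).
rewrite (bigD1 (Ordinal d0)) //= big1 => [|j j0].
  rewrite addr0 !mxE /coord_nat /= !ifT; [|lia|lia].
  rewrite expn0 !divn1 modnS (negbTE Ki); apply: (dist _ _ 1%N); lia.
rewrite !mxE /coord_nat.
have j0' : (0 < j)%N by move: j0; rewrite -val_eqE lt0n.
by rewrite !same ?subrr ?normr0 //; lia.
Qed.

Lemma sum_dvdn K n : (0 < K)%N -> (\sum_(i < n) (K %| i.+1)%N = n %/ K)%N.
Proof.
move=> K0; elim: n => [|n IH]; first by rewrite big_ord0 div0n.
by rewrite big_ord_recr /= IH divnS // addnC.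
Qed.

(** A carry costs 6dK but occurs only once in K steps, so that the average cost of a step is
    O(d). *)
Lemma gridpath_len d K n : (2 <= d)%N -> (0 < K)%N ->
  \sum_(i < n.-1) edist (gridpt d K i) (gridpt d K i.+1) <= (7 * d * n)%:R.
Proof.
move=> d2 K0; apply: le_trans (ler_sum _ (fun (i : 'I_n.-1) _ => gridpt_step i d2 K0)) _.
rewrite big_split /= sumr_const card_ord -natr_sum -natrD ler_nat -big_distrr /=.
rewrite sum_dvdn // -mulnA [(K * _)%N]mulnC.
have := leq_divM n.-1 K; have := leq_pred n; nia.
Qed.

(** * A spanning path as an upper bound for the minimum spanning tree *)

Definition path_graph d (x : nat -> pt d) (n : nat) : {fset (pt d * pt d)} :=
  [fset (x i, x i.+1) | i in iota 0 n.-1].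

Lemma path_graph_adj d (x : nat -> pt d) n i : (i.+1 < n)%N ->
  adj (path_graph x n) (x i) (x i.+1) /\ adj (path_graph x n) (x i.+1) (x i).
Proof.
move=> lt_in; have h : (x i, x i.+1) \in path_graph x n.
  by apply/imfsetP; exists i => //=; rewrite mem_iota; lia.
by rewrite /adj h orbT.
Qed.

Lemma path_graph_walk d (x : nat -> pt d) n i k : (i + k < n)%N ->
  (exists p, path (adj (path_graph x n)) (x i) p /\ last (x i) p = x (i + k)%N) /\
  (exists p, path (adj (path_graph x n)) (x (i + k)%N) p /\ last (x (i + k)%N) p = x i).
Proof.
elim: k => [|k IH] ikn; first by rewrite addn0; split; exists [::].
have [|[p [pp lp]] [q [pq lq]]] := IH; first lia.
rewrite addnS in ikn *; have [up dn] := path_graph_adj x ikn.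
split; first by exists (rcons p (x (i + k).+1)); rewrite rcons_path last_rcons lp pp.
by exists (x (i + k)%N :: q); rewrite /= dn.
Qed.

Lemma path_graph_spanning d (x : nat -> pt d) n : injective x ->
  spanning_tree [fset x i | i in iota 0 n] (path_graph x n).
Proof.
move=> xI; split.
- move=> e /imfsetP[i /= +] ->; rewrite mem_iota /= => lt_in.
  split => /=; first by apply: in_imfset; rewrite /= mem_iota; lia.
  + by apply: in_imfset; rewrite /= mem_iota; lia.
  + by apply/eqP => /xI; lia.
  + by apply/imfsetP => -[j /= _ [/xI <- /xI]]; lia.
- move=> _ _ /imfsetP[i /= + ->] /imfsetP[j /= + ->]; rewrite !mem_iota /= => lt_in lt_jn.
  have [ij|/ltnW ij] := leqP i j.
    by have [|+ _] := @path_graph_walk d x n i (j - i); rewrite subnKC.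
  by have [|_ +] := @path_graph_walk d x n j (i - j); rewrite subnKC.
- rewrite !card_imfset //=; last by move=> i j [/xI].
  by rewrite !undup_id ?iota_uniq ?size_iota.
Qed.

Lemma path_graph_weight d (x : nat -> pt d) n : injective x ->
  gweight (path_graph x n) = \sum_(i < n.-1) edist (x i) (x i.+1).
Proof.
move=> xI; rewrite /gweight big_imfset /=; last by move=> i j _ _ [/xI].
by rewrite undup_id ?iota_uniq // -[n.-1 in LHS]subn0 big_mkord.
Qed.

Lemma gweight_gt0 d (S : {fset pt d}) (T : {fset (pt d * pt d)}) :
  (1 < #|` S|)%N -> spanning_tree S T -> 0 < gweight T.
Proof.
move=> S1 [wf _ cT].
have [e eT] : exists e, e \in T by apply/fset0Pn; rewrite -cardfs_gt0 cT; lia.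
rewrite /gweight (big_fsetD1 e) //= ltr_pwDl //.
  have [_ _ ne _] := wf e eT; by rewrite edistE nrm_gt0 subr_eq0.
by apply: sumr_ge0 => f _; apply: edist_ge0.
Qed.

(** * Pairs of opposite grid points and their separation *)

Lemma rowBE d (x y : pt d) j : (x - y) ord0 j = x ord0 j - y ord0 j.
Proof. by rewrite !mxE. Qed.

(** Sources form the lower grid of pair [h], sinks the upper one. *)
Definition source (d K h s : nat) : pt d := gridpt d K (2 * h * K ^ d.-1 + s).
Definition sink (d K h t : nat) : pt d := gridpt d K ((2 * h).+1 * K ^ d.-1 + t).

Lemma gridpt_top d K l s (j : 'I_d) : j = d.-1 :> nat -> (s < K ^ d.-1)%N ->
  gridpt d K (l * K ^ d.-1 + s) ord0 j = (height d K l)%:R.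
Proof.
move=> jd sM; rewrite mxE /coord_nat jd ltnn divnMDl ?(leq_ltn_trans _ sM) //.
by rewrite divn_small // addn0.
Qed.

Lemma source_top d K h s (j : 'I_d) : j = d.-1 :> nat -> (s < K ^ d.-1)%N ->
  source d K h s ord0 j = (h * (5 * d * K))%:R.
Proof.
move=> jd sM; rewrite /source gridpt_top // /height mulKn // -[X in (X %% 2)%N]addn0.
by rewrite [(2 * h)%N]mulnC modnMDl mod0n addn0 -mulnA.
Qed.

Lemma sink_sub_source_top d K h s t (j : 'I_d) : j = d.-1 :> nat ->
  (s < K ^ d.-1)%N -> (t < K ^ d.-1)%N ->
  (sink d K h t - source d K h s) ord0 j = K%:R.
Proof.
move=> jd sM tM; rewrite rowBE source_top // /sink gridpt_top // /height.
rewrite -addn1 [(2 * h)%N]mulnC divnMDl // modnMDl addn0 mulnDl mul1n natrD.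
by rewrite !mulnA addrAC subrr add0r.
Qed.

(** The last coordinate of the difference is K, and the others are at most K in absolute value. *)
Lemma sink_sub_source_nrm d K h s t : (0 < d)%N -> (s < K ^ d.-1)%N -> (t < K ^ d.-1)%N ->
  K%:R <= nrm (sink d K h t - source d K h s) <= d%:R * K%:R.
Proof.
move=> d0 sM tM; have dd : (d.-1 < d)%N by rewrite prednK.
apply/andP; split.
  rewrite -(@sink_sub_source_top d K h s t (Ordinal dd)) //.
  exact: le_trans (ler_norm _) (coord_le_nrm _ _).
apply: le_trans (nrm_le_l1 _) _; rewrite mulr_natl -[X in _ *+ X]card_ord -sumr_const.
apply: ler_sum => j _; have [jd|jd] := ltnP j d.-1; last first.
  by rewrite sink_sub_source_top ?normr_nat //; have := ltn_ord j; lia.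
have K0 : (0 < K)%N by case: (K) sM => // ; rewrite exp0n //; lia.
rewrite !mxE /coord_nat jd; set u := (_ %% K)%N; set v := (_ %% K)%N.
have : (u <= K)%N by apply/ltnW/ltn_pmod.
have : (v <= K)%N by apply/ltnW/ltn_pmod.
rewrite -!(ler_nat real) ler_norml; have := ler0n real u; have := ler0n real v => *.
by apply/andP; split; lra.
Qed.

Lemma int_gridpt d K i j : gridpt d K i ord0 j \is a Num.int.
Proof. by rewrite mxE natr_int. Qed.

(** With p = q - a and w = b - a, Cauchy-Schwarz for w - p and w bounds the defect by (|p| + |w - p|
    - |w|)|w|. *)
Lemma near_pair_defect d (eps : real) (a b q : pt d) : near_pair eps a b q ->
  nrm (q - a) * nrm (b - a) - dot (q - a) (b - a) <= eps * nrm (b - a) ^+ 2.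
Proof.
rewrite /near_pair !edistE [nrm (a - q)]nrmBC [nrm (a - b)]nrmBC [nrm (q - b)]nrmBC => near.
have := dot_le_nrm (b - q) (b - a).
have -> : b - q = (b - a) - (q - a) by rewrite opprB addrA subrK.
rewrite [dot (_ - (_ - _)) _]dotDl dotNl -nrm_sqr.
have -> : (b - a) - (q - a) = b - q by rewrite opprB addrA subrK.
have := ler_wpM2r (nrm_ge0 (b - a)) near; lra.
Qed.

Lemma near_pair_dist d (eps : real) (a b q : pt d) : eps <= 1 -> near_pair eps a b q ->
  nrm (q - a) <= 2 * nrm (b - a).
Proof.
rewrite /near_pair !edistE [nrm (a - q)]nrmBC [nrm (a - b)]nrmBC => e1 near.
have := ler_wpM2r (nrm_ge0 (b - a)) e1; have := nrm_ge0 (q - b); lra.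
Qed.

Lemma good_edgeE d (r : real) (a b : pt d) e : good_edge (r ^+ 2) a b e ->
  (1 - 2 * r ^+ 2) * (nrm (e.2 - e.1) * nrm (b - a)) <= dot (e.2 - e.1) (b - a).
Proof. by rewrite /good_edge !edistE [nrm (a - b)]nrmBC [nrm (e.1 - _)]nrmBC. Qed.

(** The height of e.1 determines h, the direction of e determines the difference of sink and source,
    and then the position of e.1 determines the source. *)
Lemma grid_separation d K (r : real) (h h' s s' t t' : nat) (e : pt d * pt d) :
  (2 <= d)%N -> (0 < K)%N -> 0 < r -> r <= 1 ->
  K = 1%N \/ 4 * r * (d%:R * (1 + d%:R)) * K%:R < 1 ->
  (s < K ^ d.-1)%N -> (s' < K ^ d.-1)%N -> (t < K ^ d.-1)%N -> (t' < K ^ d.-1)%N ->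
  e.1 != e.2 ->
  near_pair (r ^+ 2) (source d K h s) (sink d K h t) e.1 ->
  near_pair (r ^+ 2) (source d K h' s') (sink d K h' t') e.1 ->
  good_edge (r ^+ 2) (source d K h s) (sink d K h t) e ->
  good_edge (r ^+ 2) (source d K h' s') (sink d K h' t') e ->
  [/\ h = h', s = s' & t = t'].
Proof.
move=> d2 K0 r0 r1 small sM s'M tM t'M ne near near' good good'.
have d0 : (0 < d)%N by lia.
have dd : (d.-1 < d)%N by rewrite prednK.
pose top := Ordinal dd; have topE : top = d.-1 :> nat by [].
have eps1 : r ^+ 2 <= 1 by rewrite expr_le1 // ltW.
have K0r : 0 < K%:R :> real by rewrite ltr0n.
have /andP[wK wdK] := sink_sub_source_nrm h d0 sM tM.
have /andP[w'K w'dK] := sink_sub_source_nrm h' d0 s'M t'M.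
have hh' : h = h'.
  have := near_pair_dist eps1 near; have := near_pair_dist eps1 near'.
  move=> l' l; have := coord_le_nrm (e.1 - source d K h s) top.
  have := coord_le_nrm (e.1 - source d K h' s') top.
  rewrite !rowBE !source_top // !ler_norml => /andP[c1 c2] /andP[c3 c4].
  have dK0 : (0 < d%:R * K%:R :> real) by rewrite mulr_gt0 // ltr0n.
  have hle (x y : nat) : (x * (5 * d * K))%:R <= (y * (5 * d * K))%:R + 4 * (d%:R * K%:R) :> real ->
     (x <= y)%N.
    rewrite -!natrM -natrD ler_nat => xy; suff : (x * 5 <= y * 5 + 4)%N by clear; lia.
    by rewrite -(leq_pmul2r (_ : 0 < d * K)%N) ?muln_gt0 ?d0 // mulnDl -!mulnA !(mulnA 5).
  by apply/eqP; rewrite eqn_leq; apply/andP; split; apply: hle; lra.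
subst h'.
(* For K = 1 each grid is a single point, and h alone determines the pair. *)
have [K1|{}small] := small.
  by subst K; move: sM s'M tM t'M; rewrite exp1n !ltnS !leqn0 => /eqP-> /eqP-> /eqP-> /eqP->.
have ww' : sink d K h t - source d K h s = sink d K h t' - source d K h s'.
  apply/eqP; rewrite -subr_eq0; apply/eqP; apply: int_row_eq0.
    by move=> j; rewrite !rowBE ?rpredB ?int_gridpt.
  apply: le_lt_trans small; apply: (@close_directions _ _ _ _ (e.2 - e.1) _ _ _ top) => //.
  - exact: ltW.
  - by rewrite nrm_gt0 subr_eq0 eq_sym.
  - exact: sink_sub_source_top.
  - exact: sink_sub_source_top.
  - exact: good_edgeE.
  - exact: good_edgeE.
have aa' : source d K h s = source d K h s'.
  apply/eqP; rewrite -subr_eq0; apply/eqP; apply: int_row_eq0.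
    by move=> j; rewrite !rowBE ?rpredB ?int_gridpt.
  apply: le_lt_trans small.
  apply: (@close_sources _ _ (sink d K h t - source d K h s) _ _ e.1 _ _ _ top) => //.
  - exact: ltW.
  - exact: sink_sub_source_top.
  - by rewrite !source_top.
  - exact: near_pair_dist near.
  - by rewrite ww'; apply: near_pair_dist near'.
  - exact: near_pair_defect.
  - by rewrite ww'; apply: near_pair_defect.
have bb' : sink d K h t = sink d K h t'.
  by move: ww'; rewrite aa' => /addIr.
by split=> //; [have /addnI := gridpt_inj d0 K0 aa' | have /addnI := gridpt_inj d0 K0 bb'].
Qed.

(** Only the m complete pairs of grids are charged. Each has M^2 pairs of points at distance at
    least K; the 4 combines the half carried by good edges with the two orientations. *)
Lemma grid_spanner_lower_bounds d K n (r : real) (V : {fset pt d}) (E : {fset (pt d * pt d)}) :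
  (2 <= d)%N -> (0 < K)%N -> 0 < r -> r <= 1 ->
  K = 1%N \/ 4 * r * (d%:R * (1 + d%:R)) * K%:R < 1 ->
  steiner_spanner (r ^+ 2) [fset gridpt d K i | i in iota 0 n] V E ->
  let M := (K ^ d.-1)%N in let m := (n %/ (2 * M))%N in
  (m * M ^ 2 * K)%:R <= 4 * gweight E /\ (m * M ^ 2 <= 2 * #|` E|)%N.
Proof.
move=> d2 K0 r0 r1 small span M m.
have M0 : (0 < M)%N by rewrite expn_gt0 K0.
have d0 : (0 < d)%N by lia.
pose I : finType := ('I_m * ('I_M * 'I_M))%type.
pose a (i : I) := source d K i.1 i.2.1.
pose b (i : I) := sink d K i.1 i.2.2.
have inS l s : (l < 2 * m)%N -> (s < M)%N ->
    gridpt d K (l * M + s) \in [fset gridpt d K i | i in iota 0 n].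
  move=> lm sM; apply: in_imfset; rewrite /= mem_iota add0n /=.
  have := leq_divM n (2 * M); rewrite -/m; nia.
have L0 i : K%:R <= edist (a i) (b i).
  rewrite edistE nrmBC; have [] := andP (@sink_sub_source_nrm d K i.1 i.2.1 i.2.2 d0 _ _) => //.
have cardI : #|I| = (m * M ^ 2)%N by rewrite !card_prod !card_ord -mulnn.
have r20 : 0 < r ^+ 2 by rewrite exprn_gt0.
have [||||] := @spanner_lower_bounds d (r ^+ 2) _ V E I a b r20 span.
- by move=> [h [s t]]; apply: inS => //=; have := ltn_ord h; lia.
- by move=> [h [s t]]; apply: inS => //=; have := ltn_ord h; lia.
- by move=> i; apply: lt_le_trans (L0 i); rewrite ltr0n.
- move=> [h [s t]] [h' [s' t']] e ne n1 n2 g1 g2.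
  have [||||] := @grid_separation d K r h h' s s' t t' e d2 K0 r0 r1 small _ _ _ _ ne n1 n2 g1 g2 => //.
  by move=> /val_inj -> /val_inj -> /val_inj ->.
rewrite cardI -natrM ler_nat => wE cE; split => //.
have : (m * M ^ 2)%:R * (K%:R / 2) <= 2 * gweight E.
  apply: le_trans wE; rewrite -cardI mulr_natl -sumr_const.
  by apply: ler_sum => i _; have := L0 i; lra.
rewrite natrM; lra.
Qed.

(** * Choice of the grid size and of the constants *)

Lemma powR_half (x : real) k : 0 <= x -> x `^ (- k%:R / 2) = (Num.sqrt x)^-1 ^+ k.
Proof.
move=> x0; rewrite mulrC powRrM powR12_sqrt // powRN powR_mulrn ?sqrtr_ge0 //.
by rewrite exprVn.
Qed.

(** K is c/r rounded down, or 1 if that is at most 1. The rounding loses at most a factor 2. *)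
Lemma exists_grid_size (c r : real) : 0 < c -> c <= 1 -> 0 < r -> r <= 1 ->
  exists K : nat, [/\ (0 < K)%N, c / 2 * r^-1 <= K%:R, K%:R <= r^-1 &
    K = 1%N \/ r * K%:R <= c].
Proof.
move=> c0 c1 r0 r1; have x0 : 0 <= c / r by rewrite divr_ge0 ?ltW.
have /andP[lo hi] := truncn_itv x0.
have ri : 1 <= r^-1 by rewrite invf_ge1.
have cr : c * r^-1 <= r^-1 by rewrite ler_piMl //; lra.
have [t0|t1] := leqP (Num.truncn (c / r)) 1.
  exists 1%N; split => //; last by left.
  have : ((Num.truncn (c / r)).+1%:R <= 2 :> real) by rewrite ler_nat.
  by move: hi; lra.
exists (Num.truncn (c / r)); split; [lia| |lra|right].
  have : (1 <= (Num.truncn (c / r))%:R :> real) by rewrite ler1n; lia.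
  by move: hi; rewrite -natr1; lra.
by rewrite mulrC -ler_pdivlMr.
Qed.

Theorem theorem1 (d : nat) (hd : (2 <= d)%N) :
  exists c1 c2 c3 : real, [/\ 0 < c1, 0 < c2 & 0 < c3] /\
  forall (eps : real) (n : nat), 0 < eps -> eps <= 1 ->
    c1 * eps `^ ((1 - d%:R) / 2) <= n%:R ->
    exists S : {fset pt d}, #|` S| = n /\
      forall (V : {fset pt d}) (E : {fset (pt d * pt d)}),
        steiner_spanner eps S V E ->
        (forall T, is_MST S T -> c2 * eps `^ (- d%:R / 2) <= lightness S T E) /\
        c3 * eps `^ ((1 - d%:R) / 2) <= sparsity S E.
Proof.
have d0 : (0 < d)%N by lia.
have d1r : 1 <= d%:R :> real by rewrite ler1n.
(* With rK <= c, the separation bound 4r d(1 + d)K is at most 1/2. *)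
pose c : real := (8 * (d%:R * (1 + d%:R)))^-1.
have c0 : 0 < c by rewrite invr_gt0; nra.
have c1 : c <= 1 by rewrite invf_le1; nra.
(* The 2 makes room for one complete pair of grids. As n <= 4mM, the tree weighs at most 7dn <=
   28dmM; 112 = 4 * 28 includes the 4 of the weight bound, and 8 = 4 * 2 the 2 of the edge count. *)
exists 2, ((c / 2) ^+ d / (112 * d%:R)), ((c / 2) ^+ d.-1 / 8).
split; first by split; rewrite // divr_gt0 ?exprn_gt0 ?mulr_gt0 ?divr_gt0 //; lra.
move=> eps n eps0 eps1.
pose r := Num.sqrt eps; have r0 : 0 < r by rewrite sqrtr_gt0.
have epsE : eps = r ^+ 2 by rewrite sqr_sqrtr // ltW.
have r1 : r <= 1 by rewrite -[leRHS]sqrtr1 ler_sqrt.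
have -> : (1 - d%:R : real) = - d.-1%:R by rewrite -{1}(prednK d0) -natr1; lra.
rewrite !(powR_half _ (ltW eps0)) -/r => hn.
have [K [K0 Klo Khi Ksmall]] := exists_grid_size c0 c1 r0 r1.
have small : K = 1%N \/ 4 * r * (d%:R * (1 + d%:R)) * K%:R < 1.
  case: Ksmall => [|Ksmall]; [by left|right].
  have D0 : 0 < d%:R * (1 + d%:R) :> real by nra.
  have := ler_wpM2l (ltW D0) Ksmall.
  have -> : d%:R * (1 + d%:R) * c = 1 / 8 by rewrite /c invfM mulrCA divff ?mulr1 ?div1r // gt_eqF.
  lra.
set M := (K ^ d.-1)%N; pose m := (n %/ (2 * M))%N.
have M0 : (0 < M)%N by rewrite expn_gt0 K0.
have cr0 : 0 <= c / 2 * r^-1 by rewrite mulr_ge0 ?invr_ge0 //; lra.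
have Mn : (2 * M <= n)%N.
  rewrite -(ler_nat real); apply: le_trans hn; rewrite natrM ler_pM2l // natrX.
  by rewrite lerXn2r ?nnegrE // invr_ge0 ltW.
have m0 : (0 < m)%N by rewrite divn_gt0 // muln_gt0.
(* n < 2M(m + 1), and m + 1 <= 2m because m is positive. *)
have nm : (n <= 4 * (m * M))%N.
  have M20 : (0 < 2 * M)%N by rewrite muln_gt0.
  apply: leq_trans (ltnW (ltn_ceil n M20)) _.
  rewrite -/m (_ : 4 = 2 * 2)%N // mulnACA leq_mul2r.
  by rewrite [(2 * m)%N]mul2n -addnn (leq_add m0 (leqnn m)) orbT.
have n2 : (1 < n)%N by apply: leq_trans (leq_pmulr 2 M0) Mn.
have gI := gridpt_inj d0 K0.
exists [fset gridpt d K i | i in iota 0 n].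
have cardS : #|` [fset gridpt d K i | i in iota 0 n]| = n.
  by rewrite card_imfset //= undup_id ?iota_uniq // size_iota.
split => // V E; rewrite epsE => span.
have [wE cE] := grid_spanner_lower_bounds hd K0 r0 r1 small span.
rewrite -/M -/m in wE cE.
split.
  move=> T [ST mST]; rewrite /lightness.
  have T0 : 0 < gweight T by apply: gweight_gt0 ST; rewrite cardS.
  (* A minimum spanning tree is no heavier than the row-major path. *)
  have Tle : gweight T <= (28 * d * (m * M))%:R.
    apply: le_trans (mST _ (path_graph_spanning n gI)) _; rewrite path_graph_weight //.
    apply: le_trans (gridpath_len n hd K0) _.
    by rewrite ler_nat (_ : 28 = 7 * 4)%N // [(7 * 4 * d)%N]mulnAC -[leqRHS]mulnA leq_mul2l nm orbT.
  rewrite ler_pdivlMr //.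
  have Kd : (c / 2) ^+ d * r^-1 ^+ d <= K%:R ^+ d.
    by rewrite -exprMn lerXn2r ?nnegrE.
  have d112 : 0 < 112 * d%:R :> real by lra.
  apply: (@le_trans _ _ (K%:R ^+ d / (112 * d%:R) * (28 * d * (m * M))%:R)).
    apply: ler_pM => //; last 1 first.
    - rewrite mulrAC ler_pM2r ?invr_gt0 //.
    - by rewrite mulr_ge0 ?divr_ge0 ?exprn_ge0 ?invr_ge0 ?ltW //; lra.
    - exact: ltW.
  have -> : K%:R ^+ d = (M * K)%:R :> real by rewrite -natrX /M -{1}(prednK d0) expnSr.
  rewrite -(ler_pM2l (_ : 0 < 4 :> real)) //; apply: le_trans wE.
  rewrite !natrM natrX; rewrite le_eqVlt; apply/orP; left; apply/eqP; field.
  by rewrite gt_eqF //; lra.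
rewrite /sparsity cardS.
have n1 : 0 < n.-1%:R :> real by rewrite ltr0n -subn1 subn_gt0.
rewrite ler_pdivlMr //.
have KM : (c / 2) ^+ d.-1 * r^-1 ^+ d.-1 <= M%:R.
  by rewrite -exprMn natrX lerXn2r ?nnegrE.
apply: (@le_trans _ _ (M%:R / 8 * (4 * (m * M))%:R)).
  apply: ler_pM; rewrite ?ler0n //.
  - rewrite mulr_ge0 // ?divr_ge0 ?exprn_ge0 // ?invr_ge0 ?ltW //; lra.
  - by rewrite mulrAC ler_pM2r // invr_gt0.
  - by rewrite ler_nat; apply: leq_trans (leq_pred n) nm.
move: cE; rewrite -(ler_nat real) !natrM natrX; lra.
Qed.
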